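(* For all integers $a,b\geq 3$ there is a secure and informative protocol for card deals of size $(a,b,1)$.
   Context: Cards are the integers $0,\dots,d-1$ with $d=a+b+1$. A deal of size $(a,b,c)$ is a triple $(A,B,C)$ of pairwise disjoint subsets of $\{0,\dots,d-1\}$ of sizes $a,b,c$ held by Alice, Bob and Cath respectively; initially each player knows only her own hand and the sizes. A protocol is a finite sequence of public, truthful announcements by Alice and Bob (here: one announcement by Alice followed by one by Bob), where an announcement by a player is a set of possible hands of that player containing her actual hand, chosen as a function of her own hand; its effect is to restrict the set of possible deals to those in which that player holds one of the announced hands. A player knows that a player holds card $z$ if this holds in all deals consistent with the announcements so far in which the knowing player has her actual hand; a player knows the deal if exactly one such deal remains. The protocol is informative if for every deal, after Alice's announcement Bob knows the deal and after Bob's announcement Alice knows the deal. It is secure if for every deal, after each announcement, Cath does not know for any card $z\notin C$ that Alice holds $z$, nor that Bob holds $z$. *)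

(* Defs.v *)
From mathcomp Require Import all_boot.

Set Implicit Arguments.
Unset Strict Implicit.
Unset Printing Implicit Defensive.

Inductive player := Alice | Bob | Cath.

Section RussianCards.

Variables a b c : nat.

Definition deck := 'I_(a + b + c).
Definition hand := {set deck}.

Definition hand_size (p : player) : nat :=
  match p with Alice => a | Bob => b | Cath => c end.

(* An arbitrary triple of hands; the deals of size (a, b, c) are the triples
   satisfying [is_deal]. *)
Record triple := Triple { aliceH : hand; bobH : hand; cathH : hand }.

Definition hand_of (D : triple) (p : player) : hand :=
  match p with Alice => aliceH D | Bob => bobH D | Cath => cathH D end.

Definition is_deal (D : triple) : Prop :=
  [/\ forall p, #|hand_of D p| = hand_size p,
      [disjoint aliceH D & bobH D],
      [disjoint aliceH D & cathH D]
    & [disjoint bobH D & cathH D]].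

Definition announcement := (player * {set hand})%type.

Fixpoint consistent (anns : seq announcement) (D : triple) : Prop :=
  match anns with
  | [::] => is_deal D
  | (p, X) :: anns' => hand_of D p \in X /\ consistent anns' D
  end.

(* The deals that player [i] considers possible after the announcements [anns]
   when the actual deal is [D]. *)
Definition possible (anns : seq announcement) (i : player) (D D' : triple)
    : Prop :=
  consistent anns D' /\ hand_of D' i = hand_of D i.

Definition knows_holds (anns : seq announcement) (i : player) (D : triple)
    (p : player) (z : deck) : Prop :=
  forall D', possible anns i D D' -> z \in hand_of D' p.

Definition knows_deal (anns : seq announcement) (i : player) (D : triple)
    : Prop :=
  exists! D', possible anns i D D'.

(* What player [p] announces, as a function of the hand of [p] alone: a set of
   hands of the right size that contains the actual hand. *)
Definition truthful (p : player) (f : hand -> {set hand}) : Prop :=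
  forall H : hand, #|H| = hand_size p ->
    H \in f H /\ (forall H' : hand, H' \in f H -> #|H'| = hand_size p).

Record protocol := Protocol {
  alice_says : hand -> {set hand};
  bob_says : hand -> {set hand};
  alice_truthful : truthful Alice alice_says;
  bob_truthful : truthful Bob bob_says
}.

Definition after_alice (P : protocol) (D : triple) : seq announcement :=
  [:: (Alice, alice_says P (aliceH D))].

Definition after_bob (P : protocol) (D : triple) : seq announcement :=
  rcons (after_alice P D) (Bob, bob_says P (bobH D)).

Definition informative (P : protocol) : Prop :=
  forall D, is_deal D ->
    knows_deal (after_alice P D) Bob D /\ knows_deal (after_bob P D) Alice D.

Definition cath_ignorant (anns : seq announcement) (D : triple) : Prop :=
  forall z : deck, z \notin cathH D ->
    ~ knows_holds anns Cath D Alice z /\ ~ knows_holds anns Cath D Bob z.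

Definition secure (P : protocol) : Prop :=
  forall D, is_deal D ->
    cath_ignorant (after_alice P D) D /\ cath_ignorant (after_bob P D) D.

End RussianCards.

(* Main.v *)
Require Import Defs.
From mathcomp Require Import all_boot zify.

(** Alice announces the sum of her hand modulo [n = a + b + 1], and Bob does the
    same. Since the sum of the whole deck is known, each of them can then compute
    Cath's single card. Bob's announcement tells Cath nothing new, as she could
    already compute his sum from Alice's and her own card. What remains for
    security is that, for a set [E] of two cards (Cath's and the card [z] in
    question), every residue modulo [n] is the sum of a [k]-subset avoiding [E],
    for all relevant [k]. Replacing the subset by its complement if necessary,
    one may assume [2 k + 2 <= n]; fix [k - 2] of the elements and look for the
    last two among the pairs [{x, v - x}]. Only when [2 k + 2 = n] does the count
    of such pairs fall short, and then choosing the first [k - 2] elements so that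
    [v] is odd excludes the degenerate case [x = v - x]. *)

Set Implicit Arguments.
Unset Strict Implicit.
Unset Printing Implicit Defensive.

(** * Choosing subsets, and sums of hands modulo [n] *)

Lemma exists_subset_card (T : finType) (B : {set T}) (j : nat) :
  j <= #|B| -> exists2 F : {set T}, F \subset B & #|F| = j.
Proof.
move=> le_jB; exists [set x in take j (enum B)].
  by apply/subsetP=> x; rewrite inE => /mem_take; rewrite mem_enum.
rewrite cardsE (card_uniqP _) ?size_takel -?cardE //.
by rewrite take_uniq ?enum_uniq.
Qed.

Definition hand_sum (n : nat) (A : {set 'I_n}) : nat := \sum_(x in A) x.

Lemma hand_sumU (n : nat) (A B : {set 'I_n}) :
  [disjoint A & B] -> hand_sum (A :|: B) = hand_sum A + hand_sum B.
Proof.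
move=> dAB; rewrite /hand_sum -bigU //.
by apply: eq_bigl => x; rewrite !inE.
Qed.

Lemma hand_sum1 (n : nat) (x : 'I_n) : hand_sum [set x] = x.
Proof. exact: big_set1. Qed.

(** In [nat], [n.-1 * s] stands for the opposite of [s] modulo [n]; later targets use it as a
    subtraction. *)
Lemma addn_mod_opp (n s t : nat) :
  0 < n -> s + (t + n.-1 * s) = t %[mod n].
Proof.
by move=> n_gt0; rewrite addnCA -mulSn prednK // addnC mulnC modnMDl.
Qed.

Lemma addnI_mod (n s t1 t2 : nat) :
  s + t1 = s + t2 %[mod n] -> t1 = t2 %[mod n].
Proof. by move/eqP; rewrite eqn_modDl => /eqP. Qed.

(** * Sets of cards with a prescribed sum modulo [n] *)

Lemma double_mod_ord (n u : nat) (x : 'I_n) :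
  u < n -> x + x = u %[mod n] -> x + x = u \/ x + x = u + n.
Proof.
move=> lt_un; rewrite (modn_small lt_un) => e.
have := divn_eq (x + x) n; rewrite e => ee.
have := ltn_ord x; case: ((x + x) %/ n) ee => [|[|q]]; nia.
Qed.

(** A solution doubles to [u] or to [u + n], so the boolean [x + x < n] determines it. *)
Lemma card_halves_le2 (n u : nat) :
  u < n -> #|[set x : 'I_n | x + x == u %[mod n]]| <= 2.
Proof.
move=> lt_un; set S := [set x | _].
have injS : {in S &, injective (fun x : 'I_n => x + x < n)}.
  move=> x y; rewrite !inE => /eqP/(double_mod_ord lt_un) ex.
  move=> /eqP/(double_mod_ord lt_un) ey e; apply: val_inj => /=; lia.
by rewrite -(card_in_imset injS) (leq_trans (max_card _)) // card_bool.
Qed.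

Lemma pair_sum_avoiding (n : nat) (E : {set 'I_n}) (u : nat) :
  #|E|.*2 + #|[set x : 'I_n | x + x == u %[mod n]]| < n ->
  exists x y : 'I_n, [/\ x != y, x \notin E, y \notin E & x + y = u %[mod n]].
Proof.
move=> small; have n_gt0 : 0 < n by lia.
(* [r x] is the partner [u - x]. The bad [x] lie in [E], have their partner in [E], or are their own
   partner; injectivity of [r] bounds their number below [n]. *)
pose r (x : 'I_n) : 'I_n := Ordinal (ltn_pmod (u + n.-1 * x) n_gt0).
have rP (x : 'I_n) : x + r x = u %[mod n] by rewrite /= modnDmr addn_mod_opp.
have r_inj : injective r.
  move=> x y rxy; apply: val_inj; have := rP x; rewrite -(rP y) rxy.
  by rewrite ![_ + r y]addnC => /addnI_mod; rewrite !modn_small.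
set S := [set x | _] in small; pose T := E :|: r @^-1: E :|: S.
have cardT : #|T| < n.
  apply: leq_ltn_trans small; apply: leq_trans (leq_card_setU _ _) _.
  rewrite leq_add2r (leq_trans (leq_card_setU _ _)) // -addnn leq_add2l.
  rewrite -(card_imset _ r_inj) subset_leq_card //.
  by apply/subsetP=> _ /imsetP[x + ->]; rewrite inE.
have /subsetPn[x _] : ~~ ([set: 'I_n] \subset T).
  by apply/negP=> /subset_leq_card; rewrite cardsT card_ord; lia.
rewrite !inE !negb_or -andbA => /and3P[xE rxE xS].
exists x, (r x); split=> //.
by apply: contra xS => /eqP e; rewrite {2}e; apply/eqP.
Qed.

(** [v] is what [F] still lacks to reach [u]; two cards outside both [E] and [F] supply it. *)
Lemma subset_sum_extend (n : nat) (E F : {set 'I_n}) (u : nat) :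
  let v := (u + n.-1 * hand_sum F) %% n in
  [disjoint F & E] ->
  #|E :|: F|.*2 + #|[set x : 'I_n | x + x == v %[mod n]]| < n ->
  exists A : {set 'I_n},
    [/\ [disjoint A & E], #|A| = #|F|.+2 & hand_sum A = u %[mod n]].
Proof.
move=> v dFE small; have n_gt0 : 0 < n by lia.
have [x [y [neq_xy]]] := pair_sum_avoiding small.
rewrite !inE !negb_or => /andP[xE xF] /andP[yE yF] exy.
have dyF : [disjoint [set y] & F] by rewrite disjoints1.
have xyF : x \notin y |: F by rewrite !inE negb_or neq_xy.
have dxyF : [disjoint [set x] & y |: F] by rewrite disjoints1.
exists (x |: (y |: F)); split.
- by rewrite -setI_eq0 !setIUl !setU_eq0 !setI_eq0 !disjoints1 xE yE.
- by rewrite !cardsU1 xyF yF.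
rewrite !hand_sumU // !hand_sum1 addnA addnC -modnDmr exy /v modn_mod.
by rewrite modnDmr addn_mod_opp.
Qed.

Lemma exists_parity (n : nat) (E : {set 'I_n}) (p : bool) :
  #|E| = 2 -> 7 < n -> exists2 x : 'I_n, x \notin E & odd x = p.
Proof.
move=> cE n_gt7.
(* The three cards [p], [p + 2], [p + 4] have the right parity and cannot all lie in [E]. *)
have lt_n i : i < 3 -> p + i.*2 < n by case: p; lia.
pose s : 'I_3 -> 'I_n := fun i => Ordinal (lt_n i (ltn_ord i)).
have s_inj : injective s by move=> i j [] e; apply: val_inj => /=; lia.
have /subsetPn[_ /imsetP[i _ ->] siE] : ~~ (s @: [set: 'I_3] \subset E).
  apply/negP=> /subset_leq_card.
  by rewrite card_imset // cardsT card_ord cE.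
by exists (s i); rewrite //= oddD odd_double addbF; case: (p).
Qed.

(** Reserve an even card [e] and an odd card [o], take any [j.-1] other cards, and let the parity of
    their sum decide which of the two to add. *)
Lemma exists_subset_parity (n : nat) (E : {set 'I_n}) (j : nat) (p : bool) :
  #|E| = 2 -> 7 < n -> 0 < j -> j + 3 <= n ->
  exists F : {set 'I_n},
    [/\ [disjoint F & E], #|F| = j & odd (hand_sum F) = p].
Proof.
move=> cE n_gt7 j_gt0 le_jn.
have [e eE odd_e] := exists_parity false cE n_gt7.
have [o oE odd_o] := exists_parity true cE n_gt7.
have leG : j.-1 <= #|~: (E :|: [set e; o])|.
  have := cardsC (E :|: [set e; o]); rewrite card_ord.
  have [le _] := leq_card_setU E [set e; o]; move: le.
  by rewrite cards2 cE; case: (e != o) => /=; lia.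
have [G sG cG] := exists_subset_card leG.
have dG : [disjoint G & E :|: [set e; o]] by rewrite disjoints_subset.
have dGE : [disjoint G & E].
  by apply: disjointWr dG; apply: subsetUl.
have add1 x : x \in [set e; o] -> x \notin E -> [/\ [disjoint x |: G & E],
    #|x |: G| = j & odd (hand_sum (x |: G)) = odd x (+) odd (hand_sum G)].
  move=> xeo xE; have xG : x \notin G.
    apply/negP=> xG; have /disjoint_setI0/setP/(_ x) := dG.
    by rewrite in_setI xG in_setU xeo orbT inE.
  split; first by rewrite -setI_eq0 setIUl setU_eq0 !setI_eq0 disjoints1 xE.
    by rewrite cardsU1 xG cG; lia.
  by rewrite hand_sumU ?disjoints1 // hand_sum1 oddD.
have [Fe1 Fe2 Fe3] := add1 e (set21 _ _) eE.
have [Fo1 Fo2 Fo3] := add1 o (set22 _ _) oE.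
case: (odd (hand_sum G) =P p) => [eqp|neqp].
  by exists (e |: G); rewrite Fe3 odd_e eqp.
exists (o |: G); split; rewrite // Fo3 odd_o.
by case: p (odd _) neqp => [] [].
Qed.

Lemma subset_sum_small (n : nat) (E : {set 'I_n}) (k u : nat) :
  #|E| = 2 -> 6 < n -> 2 <= k -> k.*2 + 2 <= n ->
  exists A : {set 'I_n},
    [/\ [disjoint A & E], #|A| = k & hand_sum A = u %[mod n]].
Proof.
move=> cE n_gt6 k_ge2 le_kn; have n_gt0 : 0 < n by lia.
have cardEF (F : {set 'I_n}) : #|F| = k.-2 -> #|E :|: F| <= k.
  by move=> cF; apply: leq_trans (leq_card_setU _ _) _; rewrite cE cF; lia.
case: (ltnP (k.*2 + 2) n) => [lt_kn|ge_kn].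
  have leF : k.-2 <= #|~: E| by have := cardsC E; rewrite card_ord cE; lia.
  have [F sF cF] := exists_subset_card leF.
  have [||A [dA cA sA]] := @subset_sum_extend n E F u.
  - by rewrite disjoints_subset.
  - have := card_halves_le2 (ltn_pmod (u + n.-1 * hand_sum F) n_gt0).
    by have := cardEF F cF; lia.
  by exists A; split=> //; rewrite cA cF; lia.
(* Now [n = k.*2 + 2] is even and at least 8, so [k.-2] is positive. With this parity of [F] the
   residue [v] is odd, hence not a double modulo [n]. *)
have [|||F [dF cF pF]] := @exists_subset_parity n E k.-2 (~~ odd u) cE; try lia.
have [||A [dA cA sA]] := @subset_sum_extend n E F u => //.
  set v := (u + _) %% n.
  have odd_v : odd v.
    have := divn_eq (u + n.-1 * hand_sum F) n; rewrite -/v => /(congr1 odd).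
    rewrite !oddD !oddM pF; have -> : odd n = false by lia.
    have -> : odd n.-1 = true by lia.
    by rewrite andbF addFb andTb addbN addbb => <-.
  have -> : [set x : 'I_n | x + x == v %[mod n]] = set0.
    apply/setP=> x; rewrite !inE; apply/eqP=> /double_mod_ord.
    by move/(_ (ltn_pmod _ n_gt0)); lia.
  by rewrite cards0; have := cardEF F cF; lia.
by exists A; split=> //; rewrite cA cF; lia.
Qed.

Lemma subset_sum (n : nat) (E : {set 'I_n}) (k u : nat) :
  #|E| = 2 -> 6 < n -> 2 <= k -> k + 4 <= n ->
  exists A : {set 'I_n},
    [/\ [disjoint A & E], #|A| = k & hand_sum A = u %[mod n]].
Proof.
move=> cE n_gt6 k_ge2 le_kn; have n_gt0 : 0 < n by lia.
case: (leqP (k.*2 + 2) n) => [|lt_nk]; first exact: subset_sum_small.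
pose t := hand_sum [set: 'I_n]; pose w := hand_sum E + u.
(* The sought set is what [A] and [E] leave over, so [A] must have [n - 2 - k] cards and sum
   [t - w]. *)
have [|||A [dA cA sA]] :=
  @subset_sum_small n E (n - 2 - k) (t + n.-1 * w) cE; try lia.
have dC : [disjoint ~: (A :|: E) & A :|: E] by rewrite disjoints_subset.
exists (~: (A :|: E)); split.
- by apply: disjointWr dC; apply: subsetUr.
- have := cardsC (A :|: E); rewrite card_ord cardsU (disjoint_setI0 dA) cards0.
  by rewrite cE cA; lia.
have et : t = hand_sum (~: (A :|: E)) + (hand_sum A + hand_sum E).
  by rewrite -hand_sumU // -hand_sumU // setUC setUCr.
apply: (@addnI_mod n (hand_sum A + hand_sum E)); rewrite addnC -et.
by rewrite -addnA -/w addnC -modnDmr sA modnDmr addn_mod_opp.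
Qed.

(** * The sum protocol, its informativeness and its security *)

Section SumProtocol.

Variables a b : nat.

Local Notation triple := (triple a b 1).
Local Notation hand := (hand a b 1).
Local Notation n := (a + b + 1).

Definition same_sum (k : nat) (H : hand) : {set hand} :=
  [set H' : hand | (#|H'| == k) && (hand_sum H' == hand_sum H %[mod n])].

Lemma same_sum_truthful (p : player) :
  truthful p (same_sum (hand_size a b 1 p)).
Proof.
by move=> H cH; split=> [|H']; rewrite !inE ?cH ?eqxx // => /andP[/eqP].
Qed.

Definition sum_protocol : protocol a b 1 :=
  Protocol (@same_sum_truthful Alice) (@same_sum_truthful Bob).

Lemma deal_sum (D : triple) : is_deal D ->
  hand_sum (aliceH D) + hand_sum (bobH D) + hand_sum (cathH D)
  = hand_sum [set: deck a b 1].
Proof.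
case=> cD dAB dAC dBC.
have dABC : [disjoint aliceH D :|: bobH D & cathH D].
  by rewrite -setI_eq0 setIUl setU_eq0 !setI_eq0 dAC.
rewrite -!hand_sumU //; congr hand_sum; apply/eqP.
rewrite eqEcard subsetT /= cardsT card_ord.
rewrite cardsU (disjoint_setI0 dABC) cardsU (disjoint_setI0 dAB) !cards0.
by rewrite (cD Alice) (cD Bob) (cD Cath) /=; lia.
Qed.

Lemma deal_cover (D : triple) : is_deal D ->
  aliceH D = ~: (bobH D :|: cathH D) /\ bobH D = ~: (aliceH D :|: cathH D).
Proof.
case=> cD dAB dAC dBC.
have cU (H K : hand) : [disjoint H & K] -> #|~: (H :|: K)| = n - (#|H| + #|K|).
  move=> dHK; have := cardsC (H :|: K).
  by rewrite card_ord cardsU (disjoint_setI0 dHK) cards0; lia.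
split; apply/eqP; rewrite eqEcard cU // (cD Alice) (cD Bob) (cD Cath) /=.
  rewrite -disjoints_subset disjoint_sym -setI_eq0 setIUl setU_eq0 !setI_eq0.
  by rewrite ![[disjoint _ & aliceH D]]disjoint_sym dAB dAC; lia.
rewrite -disjoints_subset disjoint_sym -setI_eq0 setIUl setU_eq0 !setI_eq0.
by rewrite dAB disjoint_sym dBC; lia.
Qed.

(** The total being fixed, the two sums give the residue of Cath's only card, which is less than
    [n]. *)
Lemma cathH_det_sums (D D' : triple) : is_deal D -> is_deal D' ->
  hand_sum (aliceH D') = hand_sum (aliceH D) %[mod n] ->
  hand_sum (bobH D') = hand_sum (bobH D) %[mod n] -> cathH D' = cathH D.
Proof.
move=> dD dD' eA eB; have := deal_sum dD'; rewrite -(deal_sum dD).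
case: dD dD' => cD _ _ _ [cD' _ _ _].
have /cards1P[x ->] : #|cathH D'| == 1 by rewrite (cD' Cath).
have /cards1P[y ->] : #|cathH D| == 1 by rewrite (cD Cath).
rewrite !hand_sum1 => /(congr1 (modn^~ n)).
rewrite -modnDml -(modnDm _ (hand_sum (bobH D'))) eA eB modnDm modnDml.
by move/addnI_mod; rewrite !modn_small // => /val_inj->.
Qed.

Lemma triple_eq (D D' : triple) : is_deal D -> is_deal D' ->
  cathH D' = cathH D -> aliceH D' = aliceH D \/ bobH D' = bobH D -> D = D'.
Proof.
move=> /deal_cover[eA eB] /deal_cover[eA' eB'] eC.
case: D D' eA eB eA' eB' eC => A B C [A' B' C'] /= eA eB eA' eB' eC [] e.
  by rewrite eB eB' eC e.
by rewrite eA eA' eC e.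
Qed.

Lemma sum_protocol_informative : informative sum_protocol.
Proof.
move=> D dD; have [cD _ _ _] := dD.
have memA : aliceH D \in same_sum a (aliceH D) by rewrite inE (cD Alice) !eqxx.
have memB : bobH D \in same_sum b (bobH D) by rewrite inE (cD Bob) !eqxx.
split; exists D; split.
- by split=> //; split.
- case=> A' B' C' [/= [+ dD'] eB]; rewrite inE => /andP[_ /eqP eA].
  apply: triple_eq => //; last by right.
  by apply: cathH_det_sums => //=; rewrite eB.
- by split=> //; split=> //; split.
case=> A' B' C' [/= [_ [+ dD']] eA]; rewrite inE => /andP[_ /eqP eB].
apply: triple_eq => //; last by left.
by apply: cathH_det_sums => //=; rewrite eA.
Qed.

(** Alice's sum and Cath's card force Bob's sum through the total, so the new deal also survives
    Bob's announcement. *)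
Lemma possible_deal (D : triple) (A : hand) : is_deal D ->
  #|A| = a -> [disjoint A & cathH D] ->
  hand_sum A = hand_sum (aliceH D) %[mod n] ->
  possible (after_bob sum_protocol D) Cath D
    (Triple A (~: (A :|: cathH D)) (cathH D)).
Proof.
move=> dD cA dAC eA; have [cD _ _ _] := dD.
have cB : #|~: (A :|: cathH D)| = b.
  have := cardsC (A :|: cathH D).
  rewrite card_ord cardsU (disjoint_setI0 dAC) cards0 cA (cD Cath) /=; lia.
have dD' : is_deal (Triple A (~: (A :|: cathH D)) (cathH D)).
  split=> //=; first by case=> //=; apply: (cD Cath).
    by rewrite disjoints_subset setCK subsetUl.
  by rewrite disjoints_subset setCS subsetUr.
split=> //=; rewrite !inE cA cB eA !eqxx; do !split=> //=.
apply/eqP/(@addnI_mod _ (hand_sum A + hand_sum (cathH D))).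
have := deal_sum dD'; rewrite -(deal_sum dD) /= => e.
rewrite -[in RHS]addnA -[in RHS]modnDml eA modnDml.
by congr (_ %% _); lia.
Qed.

Lemma after_bob_possible (P : protocol a b 1) (i : player) (D D' : triple) :
  possible (after_bob P D) i D D' -> possible (after_alice P D) i D D'.
Proof. by case=> -[? [? ?]] ?. Qed.

Lemma sum_protocol_secure : 3 <= a -> 3 <= b -> secure sum_protocol.
Proof.
move=> a_ge3 b_ge3 D dD.
(* Every deal possible after Bob's announcement was possible before it, so later ignorance implies
   earlier ignorance. *)
suff ign : cath_ignorant (after_bob sum_protocol D) D.
  split=> // z /ign[nA nB].
  by split=> kn; [apply: nA | apply: nB] => D' /after_bob_possible/kn.
have [cD _ _ _] := dD.
have /cards1P[c eC] : #|cathH D| == 1 by rewrite (cD Cath).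
move=> z; rewrite {1}eC inE => neq_zc.
have cE : #|[set z; c]| = 2 by rewrite cards2 neq_zc.
have n_gt6 : 6 < n by lia.
split=> kn.
  have [||A [dA cA sA]] := subset_sum (k := a) (hand_sum (aliceH D)) cE n_gt6;
    try lia.
  have dAC : [disjoint A & cathH D].
    by apply: disjointWr dA; rewrite eC subsetUr.
  have /= zA := kn _ (possible_deal dD cA dAC sA).
  by have := disjointFr dA zA; rewrite set21.
(* To refute that Bob surely holds [z], give [z] to Alice and complete her hand with [a.-1 >= 2]
   cards whose sum is hers minus [z]. *)
have [||A [dA cA sA]] := subset_sum (k := a.-1)
    (hand_sum (aliceH D) + n.-1 * z) cE n_gt6; try lia.
have zA : z \notin A by rewrite (disjointFl dA) // set21.
have [] : z \in ~: ((z |: A) :|: cathH D) -> False by rewrite !inE eqxx.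
apply: (kn _ (possible_deal dD _ _ _)).
- by rewrite cardsU1 zA cA; lia.
- rewrite eC disjoint_sym disjoints1 !inE negb_or eq_sym neq_zc /=.
  by rewrite (disjointFl dA) // set22.
rewrite hand_sumU ?disjoints1 // hand_sum1 -modnDmr sA modnDmr.
by rewrite addn_mod_opp //; lia.
Qed.

End SumProtocol.

Theorem mainTheorem8 (a b : nat) (ha : 3 <= a) (hb : 3 <= b) :
  exists P : protocol a b 1, secure P /\ informative P.
Proof.
exists (sum_protocol a b); split; first exact: sum_protocol_secure.
exact: sum_protocol_informative.
Qed.
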